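(* Let $t\geq 4$ and let $G$ be a $K_{2,t}$-minor free graph of order $n\geq t^2+4t+1$. Then $$q(G)\leq \frac{n+2t-2+\sqrt{(n-2t+2)^2+8t-8}}{2},$$ with equality if and only if $n\equiv 1 \pmod t$ and $G=F_{2,t}(n)$.
   Context: All graphs are finite, simple and undirected. For a graph $G$, $Q(G)=D(G)+A(G)$ is the signless Laplacian matrix ($D(G)$ the diagonal degree matrix, $A(G)$ the adjacency matrix), and $q(G)$ denotes its largest eigenvalue. A graph $H$ is a minor of $G$ if $H$ can be obtained from $G$ by deleting edges, contracting edges, or deleting vertices; $G$ is $H$-minor free if it has no minor isomorphic to $H$. $K_{s,t}$ is the complete bipartite graph with parts of sizes $s$ and $t$, and $K_m$ the complete graph on $m$ vertices. $G\cup H$ is disjoint union, $G\vee H$ is the join (disjoint union plus all edges between the two vertex sets), and $k\cdot G$ is the disjoint union of $k$ copies of $G$. For $2\le s\le t$, write $n-s+1=pt+r$ with $0\le r<t$, and set $F_{s,t}(n):=K_{s-1}\vee(p\cdot K_t\cup K_r)$ (where $K_0$ is the empty graph). *)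

(* Defs.v *)
From HB Require Import structures.
From mathcomp Require Import all_boot all_order all_algebra.
From mathcomp Require Import reals.
Set Implicit Arguments. Unset Strict Implicit. Unset Printing Implicit Defensive.
Import Order.TTheory GRing.Theory Num.Theory.

Record sgraph := SGraph { nv : nat; adjg : rel 'I_nv }.
Arguments adjg : clear implicits.

Definition simple_graph (G : sgraph) :=
  symmetric (adjg G) /\ irreflexive (adjg G).

Definition isomorphic (G H : sgraph) : Prop :=
  exists f : 'I_(nv G) -> 'I_(nv H),
    bijective f /\ forall x y, adjg H (f x) (f y) = adjg G x y.

(* Contraction of the edge uv: the vertex v is removed and merged into u. *)
Definition contract_adj (k : nat) (adj : rel 'I_k.+1) (u v : 'I_k.+1)
  : rel 'I_k :=
  fun x y => (x != y) &&
    [|| adj (lift v x) (lift v y),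
        (lift v x == u) && adj v (lift v y)
      | (lift v y == u) && adj (lift v x) v].

Inductive minor_step : sgraph -> sgraph -> Prop :=
| MS_del_edge (k : nat) (adj : rel 'I_k) (u v : 'I_k) :
    adj u v ->
    minor_step (SGraph adj)
      (SGraph (fun x y => adj x y &&
                 ~~ (((x == u) && (y == v)) || ((x == v) && (y == u)))))
| MS_del_vertex (k : nat) (adj : rel 'I_k.+1) (v : 'I_k.+1) :
    minor_step (SGraph adj) (SGraph (fun x y : 'I_k => adj (lift v x) (lift v y)))
| MS_contract (k : nat) (adj : rel 'I_k.+1) (u v : 'I_k.+1) :
    adj u v -> minor_step (SGraph adj) (SGraph (contract_adj adj u v)).

Inductive minor_reach : sgraph -> sgraph -> Prop :=
| MR_refl G : minor_reach G G
| MR_step G G' G'' : minor_step G G' -> minor_reach G' G'' -> minor_reach G G''.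

Definition is_minor (H G : sgraph) : Prop :=
  exists H', minor_reach G H' /\ isomorphic H' H.

Definition minor_free (H G : sgraph) : Prop := ~ is_minor H G.

Definition Kst (s t : nat) : sgraph :=
  @SGraph (s + t) (fun x y => (x < s) != (y < s)).

(* F_{s,t}(n) = K_{s-1} \/ (p.K_t \cup K_r), n-s+1 = p t + r:
   vertices 0..s-2 form K_{s-1}; vertex i >= s-1 lies in block (i-(s-1)) %/ t;
   blocks 0..p-1 have size t, block p has size r. *)
Definition Fst (s t n : nat) : sgraph :=
  @SGraph n (fun x y => (x != y) &&
     [|| x < s.-1, y < s.-1 | (x - s.-1) %/ t == (y - s.-1) %/ t]).

Section Spectral.
Local Open Scope ring_scope.
Variable R : realType.

Definition degree (G : sgraph) (x : 'I_(nv G)) : nat := #|[set y | adjg G x y]|.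

Definition signless_laplacian (G : sgraph) : 'M[R]_(nv G) :=
  \matrix_(i, j) ((i == j)%:R * (@degree G i)%:R + (adjg G i j)%:R).

Definition largest_eigenvalue (m : nat) (A : 'M[R]_m) (a : R) : Prop :=
  eigenvalue A a /\ forall b, eigenvalue A b -> b <= a.
End Spectral.

(* Main.v *)
(* Let z be the entrywise absolute value of an eigenvector, so that
   q z_v <= d(v) z_v + sum_(u ~ v) z_u. Excluding K_{2,t} as a subgraph, i.e.
   codegrees below t, is enough for the inequality: the right-hand side Q* is the
   root larger than n of (q - (2t - 1)) (q - (n - 1)) = n - 1. If all degrees are
   below n - t, counting paths of length two gives d(v)^2 + sum_(u ~ v) d(u) <= n d(v)
   and hence q <= n < Q*. Otherwise some v has degree n - 1 - k with k < t, all other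
   degrees are at most t + k, and comparing z_v with the maximum of z elsewhere gives
   q <= n for k > 0 and q <= Q* for k = 0. For q = Q* the vertex v is dominating and
   all other degrees equal t; contracting an edge uw that avoids v then shows that
   the closed neighbourhoods of u and w in G - v differ in at most one vertex, and in
   fact agree since codegrees are below t, so G - v is a disjoint union of copies of K_t. *)
Require Import Defs.
From HB Require Import structures.
From mathcomp Require Import all_boot all_order all_algebra.
From mathcomp Require Import reals.
From mathcomp Require Import zify ring lra complex polyrcf.
Import Order.TTheory GRing.Theory Num.Theory.

Set Implicit Arguments.
Unset Strict Implicit.
Unset Printing Implicit Defensive.

(** * Minors obtained from subgraphs, common neighbours and contracted edges *)

Lemma is_minor_step (H G G' : sgraph) :
  minor_step G G' -> is_minor H G' -> is_minor H G.
Proof. by move=> st [H' [r i]]; exists H'; split=> //; apply: MR_step st r. Qed.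

Lemma spanning_subgraph_minor (k : nat) (a : rel 'I_k) (H : sgraph)
    (f : 'I_(nv H) -> 'I_k) :
  symmetric (adjg H) -> symmetric a -> bijective f ->
  (forall x y, adjg H x y -> a (f x) (f y)) -> is_minor H (SGraph a).
Proof.
move=> symH + [g fK gK].
have [m] := ubnP #|[set p | a p.1 p.2 && ~~ adjg H (g p.1) (g p.2)]|.
elim: m a => // m IH a; rewrite ltnS => le_m syma hom.
case: (set_0Vmem [set p | a p.1 p.2 && ~~ adjg H (g p.1) (g p.2)]) => [E0|[[u v]]].
  exists (SGraph a); split; first exact: MR_refl.
  exists g; split=> [|x y /=]; first by exists f.
  apply/idP/idP => [/hom|axy]; first by rewrite !gK.
  by move/setP/(_ (x, y)): E0; rewrite !inE /= axy /= => /negbFE.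
rewrite inE /= => /andP[auv nuv].
apply: is_minor_step (MS_del_edge auv) _.
apply: IH => [|x y|x y axy].
- apply: leq_trans le_m; apply: proper_card; apply/properP; split.
    by apply/subsetP=> [[x y]]; rewrite !inE /= => /andP[/andP[-> _] ->].
  by exists (u, v); rewrite !inE /= ?auv // !eqxx.
- by rewrite syma; congr (_ && ~~ _); rewrite orbC [(x == v) && _]andbC [(x == u) && _]andbC.
- rewrite hom //=; apply: contraNN nuv => /orP[] /andP[/eqP <- /eqP <-]; rewrite !fK //.
  by rewrite symH.
Qed.

(** Deleting the vertices outside the image of [f] one at a time makes [f] bijective, which reduces
    the claim to the spanning case. *)
Lemma subgraph_minor (k : nat) (a : rel 'I_k) (H : sgraph)
    (f : 'I_(nv H) -> 'I_k) :
  symmetric (adjg H) -> symmetric a -> injective f ->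
  (forall x y, adjg H x y -> a (f x) (f y)) -> is_minor H (SGraph a).
Proof.
move=> symH; elim: k a f => [|k IH] a f syma injf hom.
  apply: spanning_subgraph_minor hom => //.
  by apply: (inj_card_bij injf); rewrite card_ord.
have [v vf|fall] := pickP (fun v => v \notin codom f); last first.
  apply: spanning_subgraph_minor hom => //.
  apply: (inj_card_bij injf); rewrite -(card_codom injf).
  by apply/subset_leq_card/subsetP=> v _; have /negbFE := fall v.
have vn x : v != f x by apply: contraNneq vf => ->; apply: codom_f.
have fE x : {y | f x = lift v y} by case: (unlift_some (vn x)) => y ->; exists y.
apply: is_minor_step (MS_del_vertex a v) _.
pose g x := sval (fE x); have gE x : f x = lift v (g x) := svalP (fE x).
apply: (IH _ g) => [x y|x y gxy|x y Hxy] /=; first exact: syma.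
  by apply: injf; rewrite !gE gxy.
by rewrite -!gE hom.
Qed.

Lemma common_neighbours_minor (t k : nat) (a : rel 'I_k) (u v : 'I_k) :
  symmetric a -> irreflexive a -> u != v ->
  (t <= #|[set w | a u w && a v w]|)%N -> is_minor (Kst 2 t) (SGraph a).
Proof.
move=> syma irra uv; set S := [set w | _] => le_t.
(* Indices 0 and 1 go to [u] and [v], later ones to the common neighbours in order; by [ltS] the
   default of [nth] is never returned. *)
pose f (i : 'I_(2 + t)) :=
  if 1 < i then nth u (enum S) (i - 2) else if val i == 0 then u else v.
have ltS (i : 'I_(2 + t)) : 1 < i -> i - 2 < size (enum S).
  by move=> i1; rewrite -cardE; have := ltn_ord i; lia.
have fS (i : 'I_(2 + t)) : 1 < i -> f i \in S.
  by move=> i1; rewrite /f i1 -mem_enum mem_nth // ltS.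
have notuv (i j : 'I_(2 + t)) : 1 < i -> j <= 1 -> f i != f j.
  move=> i1 j1; rewrite {2}/f ltnNge j1 /=; move/fS: i1; rewrite inE => /andP[au av].
  by case: ifP => _; apply: contraTneq isT => fi; move: au av; rewrite fi irra.
have injf : injective f.
  move=> i j fij; apply/val_inj => /=.
  have [i1|i1] := ltnP 1 i; have [j1|j1] := ltnP 1 j.
  - move/eqP: fij; rewrite /f i1 j1 nth_uniq ?enum_uniq ?ltS //.
    by move/eqP; lia.
  - by have := notuv i j i1 j1; rewrite fij eqxx.
  - by have := notuv j i j1 i1; rewrite fij eqxx.
  - move/eqP: fij; rewrite /f !ltnNge i1 j1 /=.
    case: ifP => /eqP i0; case: ifP => /eqP j0; rewrite ?i0 ?j0 //.
    + by rewrite (negPf uv).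
    + by rewrite eq_sym (negPf uv).
    + lia.
have adjf (x y : 'I_(2 + t)) : x < 2 -> 1 < y -> a (f x) (f y).
  move=> x2 /fS; rewrite inE => /andP[au av]; rewrite {1}/f ltnNge -ltnS x2 /=.
  by case: ifP.
apply: (@subgraph_minor _ _ (Kst 2 t) f) => //= [x y|x y]; first by rewrite eq_sym.
have [x2|x2] := ltnP x 2; have [y2|y2] := ltnP y 2 => // _; first exact: adjf.
by rewrite syma; apply: adjf.
Qed.

Lemma minor_free_common_neighbours (t k : nat) (a : rel 'I_k) (u v : 'I_k) :
  symmetric a -> irreflexive a -> minor_free (Kst 2 t) (SGraph a) -> u != v ->
  (#|[set w | a u w && a v w]| < t)%N.
Proof.
move=> syma irra free uv; rewrite ltnNge; apply/negP => le_t.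
by apply: free; apply: common_neighbours_minor le_t.
Qed.

(* Contracting [uw] turns the neighbours of the pair into common neighbours of
   the contracted vertex and [v]. *)
Lemma minor_free_edge_neighbours (t k : nat) (a : rel 'I_k) (u w v : 'I_k) :
  symmetric a -> irreflexive a -> minor_free (Kst 2 t) (SGraph a) ->
  (forall x, x != v -> a v x) -> a u w -> u != v -> w != v ->
  (#|[set x | (a u x || a w x) && (x \notin [:: u; w; v])]| < t)%N.
Proof.
case: k a u w v => [|k] a u w v; first by case: u.
move=> syma irra free domv auw uv wv.
have wu : w != u by apply: contraTneq auw => ->; rewrite irra.
have [u' uE _] := unlift_some wu; have [v' vE _] := unlift_some wv.
rewrite ltnNge; apply/negP => le_t; apply: free.
apply: is_minor_step (MS_contract auw) _.
apply: (@common_neighbours_minor _ _ _ u' v').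
- move=> x y; rewrite /contract_adj eq_sym syma; congr (_ && (_ || _)).
  by rewrite orbC [a w _]syma [a _ w]syma.
- by move=> x; rewrite /contract_adj eqxx.
- by apply: contraNneq uv => uv'; rewrite uE vE uv'.
apply: leq_trans le_t _; rewrite -(card_imset _ (@lift_inj _ w)).
apply: subset_leq_card; apply/subsetP=> x; rewrite !inE !negb_or.
move=> /andP[axu /and3P[xu xw xv]].
have wx : w != x by rewrite eq_sym.
have [x' xE _] := unlift_some wx; rewrite xE mem_imset ?inE /contract_adj; last exact: lift_inj.
have nu : u' != x' by apply: contraNneq xu; rewrite xE uE => ->.
have nv : v' != x' by apply: contraNneq xv; rewrite xE vE => ->.
by rewrite nu nv -uE -vE -xE eqxx domv // /= orbA axu.
Qed.

(** * Closed neighbourhoods in the graph with [v] deleted *)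

Definition clnbhd (T : finType) (e : rel T) (v u : T) : {set T} :=
  [set x | (x == u) || (x != v) && e u x].

Lemma card_clnbhd (T : finType) (e : rel T) (v u : T) :
  irreflexive e -> u != v -> e u v -> #|clnbhd e v u| = #|[set y | e u y]|.
Proof.
move=> irr uv euv.
have -> : clnbhd e v u = u |: ([set y | e u y] :\ v).
  by apply/setP=> x; rewrite !inE.
by rewrite cardsU1 !inE irr andbF add1n [RHS](cardsD1 v) inE euv.
Qed.

(* If [z] and [a] witness that the closed neighbourhoods of the ends of [uw]
   differ, any further common neighbour [c] forces the edge [az], and then [u]
   and [z] have [t] common neighbours. *)
Lemma clnbhd_adjacent (T : finType) (e : rel T) (v : T) (t : nat) (u w : T) :
  symmetric e -> irreflexive e -> 4 <= t ->
  (forall x, x != v -> e v x) ->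
  (forall x, x != v -> #|[set y | e x y]| = t) ->
  (forall x y, x != y -> #|[set z | e x z && e y z]| < t) ->
  (forall x y, e x y -> x != v -> y != v ->
     #|[set z | (e x z || e y z) && (z \notin [:: x; y; v])]| < t) ->
  e u w -> u != v -> w != v -> clnbhd e v u = clnbhd e v w.
Proof.
move=> sym irr t4 dom deg codeg edge.
pose B := clnbhd e v.
have inB x y : (x \in B y) = (x == y) || (x != v) && e y x by rewrite inE.
have Bself x : x \in B x by rewrite inB eqxx.
have cardB x : x != v -> #|B x| = t.
  by move=> xv; rewrite card_clnbhd ?deg // sym dom.
(* Both sets have [t] elements, and their union has at most [t + 1]: [x], [y] and the at most
   [t - 1] vertices allowed by [edge]. *)
have D1 x y : e x y -> x != v -> y != v -> #|B y :\: B x| <= 1.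
  move=> exy xv yv; rewrite cardsD.
  have := cardsUI (B x) (B y); rewrite !cardB // [B y :&: _]setIC.
  suff : #|B x :|: B y| <= t.+1 by clear; lia.
  have -> : t.+1 = 2 + t.-1 by move: t4; clear; lia.
  apply: (@leq_trans #|[set x; y] :|: [set z | (e x z || e y z) && (z \notin [:: x; y; v])]|).
    apply: subset_leq_card; apply/subsetP=> z; rewrite !inE !negb_or.
    by case: (z == x); case: (z == y); case: (z == v); case: (e x z); case: (e y z).
  apply: leq_trans (leq_card_setU _ _) _; apply: leq_add; first by rewrite cards2; case: eqP.
  by have := edge x y exy xv yv; move: t4; clear; lia.
have U1 x y p q : e x y -> x != v -> y != v ->
    p \in B y -> p \notin B x -> q \in B y -> q != p -> q \in B x.
  move=> exy xv yv py px qy; apply: contraNT => qx.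
  by apply/eqP/(card_le1_eqP (D1 x y exy xv yv)); rewrite inE ?px ?qx.
move=> euw uv wv; apply/eqP; rewrite eq_sym eqEcard !cardB // leqnn andbT.
apply/subsetP=> z zw; apply/negPn/negP => zu.
have ewu : e w u by rewrite sym.
have uw : u != w by apply: contraTneq euw => ->; rewrite irr.
have wBu : w \in B u by rewrite inB wv euw orbT.
have uBw : u \in B w by rewrite inB uv ewu orbT.
have [a au aw] : exists2 a, a \in B u & a \notin B w.
  apply/subsetPn; apply: contra zu => sub.
  suff /eqP Buw : B u == B w by rewrite -/(B u) Buw.
  by rewrite eqEcard sub !cardB ?leqnn.
have nbr x y : x \in B y -> x != y -> x != v /\ e y x.
  by rewrite inB => /orP[->//|/andP[]].
have zw' : z != w by apply: contraNneq zu => ->.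
have au' : a != u by apply: contraNneq aw => ->.
have [zv ewz] := nbr _ _ zw zw'; have [av eua] := nbr _ _ au au'.
have zu' : z != u by apply: contraNneq zu => ->.
have aw' : a != w by apply: contraNneq aw => ->.
have az' : a != z by apply: contraNneq zu => <-.
have nez : ~~ e u z by apply: contra zu => euz; rewrite inB zv euz orbT.
have nea : ~~ e w a by apply: contra aw => ewa; rewrite inB av ewa orbT.
have subz x : x \in B w -> x != u -> x \in B z.
  move=> xw xu; apply: (U1 z w u) => //; first by rewrite sym.
  by rewrite inB negb_or eq_sym zu' negb_and sym nez orbT.
have suba x : x \in B u -> x != w -> x \in B a.
  move=> xu xw; apply: (U1 a u w) => //; first by rewrite sym.
  by rewrite inB negb_or eq_sym aw' negb_and sym nea orbT.
have cardI : t.-1 <= #|B u :&: B w|.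
  by rewrite -subn1 leq_subLR addnC -leq_subLR -(cardB u uv) -cardsD D1.
(* The intersection has at least [t - 1 >= 3] elements, so one of them is neither [u] nor [w]. *)
have [c] : exists2 c, c \in B u :&: B w & c \notin [set u; w].
  apply/subsetPn/negP => /subset_leq_card; rewrite cards2; move: cardI t4; case: (u == w) => /=; clear; lia.
rewrite !inE negb_or -!inB => /andP[cu cw] /andP[cu' cw'].
have ca : c != a by apply: contraNneq aw => <-.
have cz : c != z by apply: contraNneq zu => <-.
have [cv eac] := nbr _ _ (suba c cu cw') ca.
have [_ ezc] := nbr _ _ (subz c cw cu') cz.
have [_ ewc] := nbr _ _ cw cw'.
(* For the edge [ac], the one vertex of [B c] that [B a] may miss is already [w], so [z] is not
   missed. *)
have zBa : z \in B a.
  apply: (U1 a c w) => //; rewrite inB ?wv ?zv ?(sym c) ?ewc ?ezc ?orbT //.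
  by rewrite negb_or eq_sym aw' negb_and sym nea orbT.
have [|_ eaz] := nbr _ _ zBa; first by rewrite eq_sym.
have := codeg u z; rewrite eq_sym zu' => /(_ isT); apply/negP; rewrite -leqNgt.
(* The [t] common neighbours of [u] and [z] are [a], [v] and at least [t - 2] vertices of [I]. *)
pose I := (B u :&: B w) :\ u.
apply: (@leq_trans #|a |: (v |: I)|).
  have vI : v \notin I by rewrite !inE eqxx /= !(eq_sym v) (negPf uv) (negPf wv) !andbF.
  rewrite !cardsU1 vI !inE (negPf av) (negPf au') (negPf aw') (negPf nea) !andbF /=.
  by have := cardsD1 u (B u :&: B w); rewrite in_setI Bself uBw -/I; move: cardI t4; clear; lia.
apply: subset_leq_card; apply/subsetP=> x; rewrite in_setU1 in_setU1 => /or3P[/eqP->|/eqP->|].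
- by rewrite inE eua sym.
- by rewrite inE !(sym _ v) !dom.
rewrite in_setD1 in_setI => /and3P[xu xBu xBw].
have xz : x != z by apply: contraNneq zu => <-.
have [_ eux] := nbr _ _ xBu xu; have [_ ezx] := nbr _ _ (subz x xBw xu) xz.
by rewrite inE eux ezx.
Qed.

(** Closed neighbourhoods that meet are equal, so they partition the vertices other than [v] into
    cliques of size [t]. Numbering these one after the other behind [v] reproduces [Fst 2 t n]. *)
Lemma clnbhd_eq_isomorphic_Fst (t n : nat) (a : rel 'I_n) (v : 'I_n) :
  symmetric a -> irreflexive a -> 1 < t ->
  (forall x, x != v -> a v x) ->
  (forall x, x != v -> #|clnbhd a v x| = t) ->
  (forall x y, a x y -> x != v -> y != v -> clnbhd a v x = clnbhd a v y) ->
  n %% t = 1 /\ isomorphic (SGraph a) (Fst 2 t n).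
Proof.
move=> sym irr t1 dom cardB eqB; pose B := clnbhd a v.
have t0 : 0 < t by lia.
have inB x y : (x \in B y) = (x == y) || (x != v) && a y x by rewrite inE.
have Bself x : x \in B x by rewrite inB eqxx.
have BE x y : x != v -> y \in B x -> B y = B x.
  move=> xv; rewrite inB => /orP[/eqP->//|/andP[yv axy]].
  by rewrite /B (eqB _ _ axy).
pose P := B @: [set~ v].
have partP : partition P [set~ v].
  apply/and3P; split.
  - apply/eqP/setP=> x; apply/bigcupP/idP => [[_ /imsetP[y yv ->]]|xv].
      by rewrite inB => /orP[/eqP->//|/andP[xv _]]; rewrite !inE.
    by exists (B x) => //; apply: imset_f.
  - apply/trivIsetP=> _ _ /imsetP[x xv ->] /imsetP[y yv ->]; apply: contraR.
    rewrite !inE in xv yv; case/pred0Pn=> z /andP[/= zx zy].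
    by rewrite -(BE x z) // (BE y z).
  - by apply/imsetP=> -[x _ B0]; have := Bself x; rewrite -B0 inE.
have nE : n = 1 + #|P| * t.
  have := @card_uniform_partition _ t P [set~ v] _ partP.
  rewrite cardsC1 card_ord => <-; last by move=> _ /imsetP[x xv ->]; apply: cardB; rewrite !inE in xv.
  by rewrite add1n prednK //; have := ltn_ord v; lia.
pose cls x := index (B x) (enum P); pose pos x := index x (enum (B x)).
have PB x : x != v -> B x \in enum P by move=> xv; rewrite mem_enum imset_f // !inE.
have ltcls x : x != v -> cls x < #|P| by move=> xv; rewrite cardE index_mem PB.
have ltpos x : x != v -> pos x < t.
  by move=> xv; rewrite -(cardB x) // cardE index_mem mem_enum Bself.
have eqcls x y : x != v -> y != v -> (cls x == cls y) = (B x == B y).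
  move=> xv yv; apply/eqP/eqP => [E|]; last by rewrite /cls => ->.
  by rewrite -(nth_index set0 (PB x xv)) -(nth_index set0 (PB y yv)) -/(cls x) E.
(* The class of index [c] takes the [t] numbers from [1 + c * t] on, so quotient and remainder of
   [f x - 1] by [t] recover [cls x] and [pos x]. *)
pose f x := if x == v then 0 else 1 + (cls x * t + pos x).
have divf x : x != v -> (f x - 1) %/ t = cls x.
  by move=> xv; rewrite /f (negPf xv) addKn divnMDl // divn_small ?addn0 ?ltpos.
have modf x : x != v -> (f x - 1) %% t = pos x.
  by move=> xv; rewrite /f (negPf xv) addKn modnMDl modn_small ?ltpos.
have f0 x : (f x < 1) = (x == v) by rewrite /f; case: (x == v).
have ltf x : f x < n.
  rewrite [X in _ < X]nE; have [/eqP xv|xv] := boolP (x == v); first by rewrite /f xv eqxx.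
  rewrite /f (negPf xv) ltn_add2l; apply: (@leq_trans ((cls x).+1 * t)).
    by rewrite mulSn addnC ltn_add2r ltpos.
  by rewrite leq_mul2r ltcls ?orbT.
have injf x y : f x = f y -> x = y.
  move=> fxy; have [xv|xv] := eqVneq x v.
    by apply/eqP; rewrite xv eq_sym -f0 -fxy f0 xv.
  have yv : y != v by rewrite -f0 -fxy f0.
  have /eqP : cls x = cls y by rewrite -!divf ?fxy.
  rewrite eqcls // => /eqP Bxy.
  have : pos x = pos y by rewrite -!modf ?fxy.
  rewrite /pos Bxy => E.
  have yB : y \in enum (B y) by rewrite mem_enum Bself.
  have xB : x \in enum (B y) by rewrite mem_enum -Bxy Bself.
  by rewrite -(nth_index v xB) E nth_index.
split.
  by rewrite nE addnC modnMDl modn_small.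
exists (fun x => Ordinal (ltf x)); split.
  by apply: injF_bij => x y [/injf].
move=> x y /=; rewrite -(inj_eq val_inj) /= !f0.
have -> : (f x == f y) = (x == y) by apply/eqP/eqP => [/injf|->].
have [->|xy] := eqVneq x y; first by rewrite irr.
have [xv|xv] := eqVneq x v; first by rewrite xv dom //= -xv eq_sym.
have [yv|yv] := eqVneq y v; first by rewrite yv sym dom.
rewrite /= !divf // eqcls //; apply/eqP/idP => [Bxy|axy].
  by have := Bself y; rewrite -Bxy inB eq_sym (negPf xy) yv.
by rewrite /B (eqB x y).
Qed.

(** * Degree counts when all codegrees are below [t] *)

Definition deg (T : finType) (e : rel T) (x : T) := #|[set y | e x y]|.

Lemma deg_lt (T : finType) (e : rel T) (x : T) : irreflexive e -> deg e x < #|T|.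
Proof.
move=> irr; rewrite -cardsT; apply: proper_card.
by rewrite properT; apply/negP => /eqP/setP/(_ x); rewrite !inE irr.
Qed.

(** Both sides count the walks [v u w], with [w = v] allowed: the left by the middle vertex, the
    right by the end. *)
Lemma sum_deg_neighbours (T : finType) (e : rel T) (v : T) : symmetric e ->
  \sum_(u | e v u) deg e u = \sum_w #|[set u | e v u && e w u]|.
Proof.
move=> sym; under eq_bigr do rewrite /deg -sum1_card.
rewrite (exchange_big_dep predT) //=; apply: eq_bigr => w _.
by rewrite -sum1_card; apply: eq_bigl => u; rewrite !inE (sym u w).
Qed.

(** Inclusion-exclusion: the union of the two neighbourhoods has at most [#|T|] elements, their
    intersection at most [t - 1]. *)
Lemma deg_add_le (T : finType) (e : rel T) (t : nat) (x y : T) :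
  (forall x y, x != y -> #|[set z | e x z && e y z]| < t) ->
  x != y -> (deg e x + deg e y).+1 <= #|T| + t.
Proof.
move=> codeg xy; rewrite /deg -cardsUI -addnS; apply: leq_add; first exact: max_card.
by apply: leq_ltn_trans (codeg x y xy); apply: subset_leq_card; apply/subsetP=> z; rewrite !inE.
Qed.

(* For [t <= deg v] count the paths [v u w] by their end [w]; for [deg v < t],
   all neighbours of [v] but one have degree at most [(#|T| + t) / 2]. *)
Lemma sum_deg_neighbours_le (T : finType) (e : rel T) (t : nat) (v : T) :
  symmetric e -> irreflexive e ->
  (forall x y, x != y -> #|[set z | e x z && e y z]| < t) ->
  t ^ 2 + 4 * t + 1 <= #|T| -> deg e v + t < #|T| ->
  deg e v * deg e v + \sum_(u | e v u) deg e u <= #|T| * deg e v.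
Proof.
move=> sym irr codeg le_n lt_n; have [td|dt] := leqP t (deg e v).
  have : \sum_(u | e v u) deg e u <= deg e v + (#|T| - 1) * (t - 1).
    rewrite sum_deg_neighbours // (bigD1 v) //= leq_add //.
      by apply: eq_leq; apply: eq_card => u; rewrite !inE andbb.
    have -> : #|T| - 1 = #|predC1 v| by have := cardC1 v; lia.
    rewrite -sum_nat_const; apply: leq_sum => w wv.
    by have := codeg v w; rewrite eq_sym wv => /(_ isT); lia.
  (* On the range from [t] to [n - 1 - t] the concave [d (n - 1 - d)] is least at the ends, where
     [t (n - 1 - t) >= (n - 1) (t - 1)] because [n - 1 >= t ^ 2]. *)
  by move: td le_n lt_n; move: (deg e v) #|T| (\sum_(_ | _) _) => d n s; clear; nia.
have [d0|[u0 vu0]] := set_0Vmem [set y | e v y].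
  rewrite big_pred0 => [|u]; first by rewrite /deg d0 cards0.
  by move/setP/(_ u): d0; rewrite !inE.
(* The exceptional neighbour [u1] has the largest degree, so any other [u] satisfies
   [2 deg u <= deg u + deg u1]. *)
case: (@arg_maxnP _ u0 (e v) (deg e)); first by rewrite inE in vu0.
move=> u1 vu1 max1.
have le_s : \sum_(u | e v u) 2 * deg e u <=
    2 * (#|T| - 1) + (deg e v - 1) * (#|T| + t - 1).
  rewrite (bigD1 u1) //=; apply: leq_add.
    by have := deg_lt u1 irr; move: (deg e u1) #|T|; clear; lia.
  have -> : deg e v - 1 = #|[pred u | e v u && (u != u1)]|.
    rewrite /deg (cardsD1 u1) inE vu1 addKn; apply: eq_card => u.
    by rewrite !inE andbC.
  rewrite -sum_nat_const; apply: leq_sum => u /andP[vu uu1].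
  by have := deg_add_le codeg uu1; have /= := max1 u vu; move: (deg e u1) (deg e u) #|T|; clear; lia.
have d1 : 0 < deg e v by apply/card_gt0P; exists u0.
move: le_s; rewrite -big_distrr /=.
(* What remains is [(d - 1) (2 d + t + 1 - n) <= 0]. *)
by move: d1 dt le_n lt_n; move: (deg e v) #|T| (\sum_(_ | _) _) => d n s; clear; nia.
Qed.

(** At most [t - 1] neighbours of [u] are adjacent to [v]; the others lie among the [k + 1] vertices
    not adjacent to [v]. If [u] is itself one of these, then neither [u] nor [v] is a neighbour of
    [u], which saves two. *)
Lemma deg_le_codeg (T : finType) (e : rel T) (t k : nat) (u v : T) :
  symmetric e -> irreflexive e ->
  (forall x y, x != y -> #|[set z | e x z && e y z]| < t) ->
  deg e v + k.+1 = #|T| -> u != v -> deg e u + 2 * ~~ e v u <= t + k.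
Proof.
move=> sym irr codeg dv uv.
have cC : #|~: [set y | e v y]| = k.+1 by rewrite cardsCs setCK; move: dv; rewrite /deg; lia.
have cI : #|[set y | e u y] :&: [set y | e v y]| < t.
  apply: leq_ltn_trans (codeg u v uv); apply: subset_leq_card.
  by apply/subsetP=> z; rewrite !inE.
rewrite /deg -(cardsID [set y | e v y]).
have [vu|nvu] /= := boolP (e v u).
  have : #|[set y | e u y] :\: [set y | e v y]| <= k.+1.
    by rewrite -cC setDE subset_leq_card ?subsetIr.
  by move: cI; lia.
suff : #|u |: (v |: ([set y | e u y] :\: [set y | e v y]))| <= k.+1.
  by rewrite !cardsU1 !inE (negPf uv) irr !(sym u v) (negPf nvu) !andbF /=; move: cI; lia.
rewrite -cC; apply: subset_leq_card; apply/subsetP=> z.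
rewrite !inE => /or3P[/eqP->//|/eqP->|/andP[]//].
by rewrite irr.
Qed.

(** * Bounds for [b] from nonnegative vectors with [b z <= Q z] *)

Local Open Scope ring_scope.

(* Collatz-Wielandt bound for the signless Laplacian with the degrees as test
   vector. *)
Lemma subeigen_le_deg (R : realFieldType) (T : finType) (e : rel T) (N : nat)
    (z : T -> R) (b : R) :
  (forall v, 0 <= z v) -> (exists v, z v != 0) ->
  (forall v, b * z v <= (deg e v)%:R * z v + \sum_(u | e v u) z u) ->
  (forall v, deg e v * deg e v + \sum_(u | e v u) deg e u <= N * deg e v)%N ->
  b <= N%:R.
Proof.
move=> z0 [v1 zv1] zb dN; rewrite leNgt; apply/negP => ltb.
have b0 : 0 < b by apply: le_lt_trans ltb.
have d0 u : deg e u = 0%N -> z u = 0.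
  move=> du; have := zb u; rewrite du mul0r add0r big_pred0 => [zu|w].
    by apply/eqP; rewrite eq_le z0 andbT -(pmulr_rle0 _ b0).
  by apply/negP => euw; move/eqP: du; rewrite cards_eq0 => /eqP/setP/(_ w); rewrite !inE euw.
(* At degree 0 the quotient is 0 by convention, in accordance with [d0], so its maximum [c] gives
   [zle] at every vertex. *)
case: (@arg_maxP _ _ _ v1 predT (fun v => z v / (deg e v)%:R)) => // v2 _ max2.
set c := z v2 / _ in max2.
have gt0 u : z u != 0 -> 0 < (deg e u)%:R :> R.
  by rewrite ltr0n lt0n; apply: contraNneq => /d0 ->.
have c0 : 0 < c.
  by apply: lt_le_trans (max2 v1 isT); rewrite divr_gt0 ?gt0 // lt0r zv1 z0.
have zv2 : z v2 != 0 by apply: contraTneq c0 => E; rewrite /c E mul0r ltxx.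
have cE : z v2 = c * (deg e v2)%:R by rewrite /c divfK // gt_eqF ?gt0.
have zle u : z u <= c * (deg e u)%:R.
  have [->|zu] := eqVneq (z u) 0; first by rewrite mulr_ge0 // ltW.
  by rewrite -ler_pdivrMr ?gt0 //; apply: max2.
have le_s : \sum_(u | e v2 u) z u <= c * (\sum_(u | e v2 u) deg e u)%:R.
  by rewrite natr_sum mulr_sumr; apply: ler_sum => u _.
have {dN} := dN v2; rewrite -(ler_nat R) natrD !natrM => dN.
have := zb v2; have := gt0 _ zv2; move: dN le_s; rewrite cE.
move: (\sum_(u | e v2 u) z u) ((\sum_(u | e v2 u) deg e u)%:R) (deg e v2)%:R.
move=> s s' d le_s' le_s d_gt0 le_b.
have : c * d * b <= c * d * N%:R by nra.
by apply/negP; rewrite -ltNge ltr_pM2l //; apply: mulr_gt0.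
Qed.

Lemma sum_neighbours_le (R : realFieldType) (T : finType) (e : rel T)
    (z : T -> R) (X : R) (u v : T) :
  (forall w, w != v -> z w <= X) ->
  \sum_(w | e u w) z w <= (e u v)%:R * z v + ((deg e u)%:R - (e u v)%:R) * X.
Proof.
move=> zX; rewrite (bigID (pred1 v)) /=; apply: lerD.
  have [euv|neuv] := boolP (e u v).
    rewrite mul1r (big_pred1 v) // => w /=.
    by case: eqP => [->|]; rewrite ?andbT ?andbF.
  by rewrite mul0r big_pred0 // => w /=; case: eqP => [->|]; rewrite ?andbF ?(negPf neuv).
apply: (@le_trans _ _ (\sum_(w | e u w && (w != v)) X)).
  by apply: ler_sum => w /andP[_ /zX].
rewrite sumr_const -[X *+ _]mulr_natl /deg (cardsD1 v [set y | e u y]) inE natrD addrAC subrr add0r.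
by rewrite le_eqVlt; apply/orP; left; apply/eqP; congr (_%:R * _); apply: eq_card => w; rewrite !inE andbC.
Qed.

(* The witness [X] is the largest entry of [z] outside [v]. *)
Lemma subeigen_two_values (R : realFieldType) (T : finType) (e : rel T)
    (t k : nat) (z : T -> R) (b : R) (v : T) :
  symmetric e -> irreflexive e -> (1 < #|T|)%N ->
  (forall v, 0 <= z v) -> (exists v, z v != 0) ->
  (forall v, b * z v <= (deg e v)%:R * z v + \sum_(u | e v u) z u) ->
  (deg e v + k.+1 = #|T|)%N ->
  (forall u, u != v -> deg e u + 2 * ~~ e v u <= t + k)%N ->
  exists X, [/\ 0 <= X, (forall u, u != v -> z u <= X), 0 < X + z v,
    b * X <= (2 * (t + k)%:R - 1) * X + z v &
    b * z v <= (#|T|%:R - 1 - k%:R) * (z v + X)].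
Proof.
move=> sym irr T1 z0 [v1 zv1] zb dv du.
have /card_gt1P[w1 [w2 [_ _ w12]]] := T1.
have {w1 w2 w12} [u0 u0v] : exists u, u != v.
  by have [w1v|] := eqVneq w1 v; [exists w2; rewrite -w1v eq_sym|exists w1].
case: (@arg_maxP _ _ _ u0 (fun u => u != v) z u0v) => u uv maxu.
have zX w : w != v -> z w <= z u by apply: maxu.
exists (z u); split => //.
(* If [X + z v] were 0, all entries of [z] would vanish. *)
- rewrite lt0r addr_ge0 // andbT paddr_eq0 //; apply: contra zv1 => /andP[/eqP zu zv].
  have [->//|v1v] := eqVneq v1 v.
  by rewrite eq_le z0 -{1}zu zX.
- apply: le_trans (zb u) _.
  have := sum_neighbours_le e u zX; rewrite [e u v]sym.
  have := du u uv; rewrite -(ler_nat R) natrD; have := z0 u; have := z0 v.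
  move: (\sum_(w | _) _) (deg e u)%:R (t + k)%:R (z u) (z v) => s d m X y y0 X0.
  (* If [u] is adjacent to [v], the sum is at most [z v + (deg u - 1) X]. Otherwise it is at most
     [deg u * X], and the two saved in the degree bound make up for the missing [- X]. *)
  by case: (e v u) => /= dm ss; rewrite ?mulr1n ?mulr0n in ss dm *; nra.
apply: le_trans (zb v) _.
have := sum_neighbours_le e v zX; rewrite irr mul0r add0r subr0 => ss.
have -> : #|T|%:R - 1 - k%:R = (deg e v)%:R :> R by rewrite -dv natrD -addn1 natrD; ring.
by rewrite mulrDr lerD2l.
Qed.

(** If [b > n], the two inequalities give [m X <= y] and [(k + 1) y < (n - 1 - k) X] with
    [m = n - 2 (t + k) + 1], hence [(k + 1) m < n - 1 - k]. But [k > 0] and the size of [n] give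
    [(k + 1) m >= 2 m >= n - 1 - k]. *)
Lemma subeigen_le_order (R : realFieldType) (N t k : nat) (b X y : R) :
  (4 <= t)%N -> (t ^ 2 + 4 * t + 1 <= N)%N -> (0 < k < t)%N ->
  0 <= X -> 0 <= y -> 0 < X + y ->
  b * X <= (2 * (t + k)%:R - 1) * X + y ->
  b * y <= (N%:R - 1 - k%:R) * (y + X) -> b <= N%:R.
Proof.
move=> t4 leN /andP[k1 kt] X0 y0 Xy bX by_; rewrite leNgt; apply/negP => ltb.
move: t4 leN k1 kt; rewrite -!(ler_nat R) natrD natrD natrX natrM.
rewrite -[k.+1]addn1 natrD => t4 leN k1 kt.
rewrite natrD in bX; move: N%:R t%:R k%:R bX by_ ltb t4 leN k1 kt => n {}t {}k bX by_ ltb t4 leN k1 kt.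
pose m := n - 2 * (t + k) + 1.
have le_m : t ^+ 2 + 4 <= m by rewrite /m; lra.
have leXy : m * X <= y by rewrite /m; nra.
have ltyX : y != 0 -> (k + 1) * y < (n - 1 - k) * X.
  move=> yn0; have y1 : 0 < y by rewrite lt0r yn0.
  by clear - y1 ltb by_; nra.
have X1 : 0 < X.
  rewrite lt0r X0 andbT; apply/eqP => XE; move: Xy ltyX; rewrite XE add0r mulr0 => y1.
  by rewrite gt_eqF // => /(_ isT); nra.
have y1 : 0 < y by apply: lt_le_trans leXy; apply: mulr_gt0 => //; nra.
have : (k + 1) * m * X < (n - 1 - k) * X.
  apply: le_lt_trans (ltyX _); last by rewrite gt_eqF.
  by rewrite -mulrA ler_pM2l //; lra.
rewrite ltr_pM2r //; apply/negP; rewrite -leNgt.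
have : 1 * m <= k * m by rewrite ler_wpM2r //; nra.
by move: le_m; rewrite /m; nra.
Qed.

(** * The extremal value and the degrees when it is attained *)

Definition extremal_value (R : rcfType) (n t : nat) : R :=
  (n%:R + 2 * t%:R - 2 + Num.sqrt ((n%:R - 2 * t%:R + 2) ^+ 2 + 8 * t%:R - 8)) / 2.

(** The quadratic has discriminant [(n - 2 t + 2)^2 + 8 (t - 1)]. Its square root exceeds
    [n - 2 t + 2], and this puts the larger root above [n]. *)
Lemma extremal_valueP (R : rcfType) (n t : nat) : (1 < t)%N -> (2 * t <= n)%N ->
  let q := extremal_value R n t in
  n%:R < q /\ (q - (2 * t%:R - 1)) * (q - (n%:R - 1)) = n%:R - 1.
Proof.
rewrite -(ltr_nat R) -(ler_nat R) natrM => t1 tn /=; rewrite /extremal_value.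
set D := _ + _ - 8; have D0 : 0 <= D.
  by rewrite /D; have := sqr_ge0 (n%:R - 2 * t%:R + 2 : R); lra.
have ltD : n%:R - 2 * t%:R + 2 < Num.sqrt D.
  rewrite -[ltLHS]ger0_norm; last by lra.
  by rewrite -sqrtr_sqr ltr_sqrt // /D; nra.
have := sqr_sqrtr D0; move: ltD; move: (Num.sqrt D) => s ltD sD; split; first by lra.
rewrite /D in sD; nra.
Qed.

(** Eliminating [y] gives [(b - (2 t - 1)) (b - (n - 1)) <= n - 1]. The product equals [n - 1] at
    the extremal value and is strictly larger beyond it. *)
Lemma subeigen_le_extremal (R : rcfType) (N t : nat) (b X y : R) :
  (1 < t)%N -> (2 * t <= N)%N -> 0 <= X -> 0 <= y -> 0 < X + y ->
  b * X <= (2 * t%:R - 1) * X + y ->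
  b * y <= (N%:R - 1) * (y + X) -> b <= extremal_value R N t.
Proof.
move=> t1 tN X0 y0 Xy bX by_; have [ltq qE] := extremal_valueP R t1 tN.
rewrite leNgt; apply/negP; move: t1 tN; rewrite -(ltr_nat R) -(ler_nat R) natrM.
move: (extremal_value _ _ _) ltq qE => q ltq qE t1 tN ltb.
have X1 : 0 < X by rewrite lt0r X0 andbT; apply/eqP => XE; move: Xy by_; rewrite XE; nra.
have leX : (b - (2 * t%:R - 1)) * X <= y by lra.
have : (b - (N%:R - 1)) * ((b - (2 * t%:R - 1)) * X) <= (N%:R - 1) * X.
  by apply: (@le_trans _ _ ((b - (N%:R - 1)) * y)); [rewrite ler_wpM2l //; lra|lra].
rewrite mulrA ler_pM2r //; apply/negP; rewrite -ltNge -qE [ltRHS]mulrC.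
by apply: ltr_pM; lra.
Qed.
(* Equality forces all entries outside [v] to agree. *)
Lemma subeigen_extremal_deg (R : rcfType) (T : finType) (e : rel T) (t : nat)
    (z : T -> R) (v : T) :
  symmetric e -> irreflexive e -> (1 < t)%N -> (2 * t <= #|T|)%N ->
  (forall u, 0 <= z u) -> (exists u, z u != 0) ->
  (forall u, extremal_value R #|T| t * z u <= (deg e u)%:R * z u + \sum_(w | e u w) z w) ->
  (forall u, u != v -> e v u) -> (forall u, u != v -> deg e u <= t)%N ->
  forall u, u != v -> deg e u = t.
Proof.
move=> sym irr t1 tN z0 zn0 zb dom dt u uv.
have dv : (deg e v + 1 = #|T|)%N.
  rewrite addn1 /deg.
  have -> : [set y | e v y] = [set~ v].
    apply/setP=> y; rewrite !inE; have [->|/dom->//] := eqVneq y v; exact: irr.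
  by rewrite cardsC1 prednK //; apply/card_gt0P; exists v.
have T1 : (1 < #|T|)%N by apply: leq_trans tN; move: t1; clear; lia.
have du w : w != v -> (deg e w + 2 * ~~ e v w <= t + 0)%N.
  by move=> wv; rewrite dom //= !addn0 dt.
have [X [X0 zX Xv qX qv]] := subeigen_two_values sym irr T1 z0 zn0 zb dv du.
have [ltq qE] := extremal_valueP R t1 tN.
rewrite addn0 in qX.
have sE : \sum_(w | e v w) z w = \sum_(w | w != v) z w.
  by apply: eq_bigl => w; have [->|/dom->//] := eqVneq w v; rewrite irr.
have := zb v; rewrite sE.
have -> : (deg e v)%:R = #|T|%:R - 1 :> R by rewrite -dv natrD addrK.
have cE : #|T|%:R - 1 = #|predC1 v|%:R :> R.
  by rewrite -dv natrD addrK; congr _%:R; have := cardC1 v; move: dv; clear; lia.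
have SX : \sum_(w | w != v) (X - z w) = (#|T|%:R - 1) * X - \sum_(w | w != v) z w.
  by rewrite sumrB sumr_const -[X *+ _]mulr_natl cE.
have S0 : 0 <= \sum_(w | w != v) (X - z w).
  by apply: sumr_ge0 => w /zX; rewrite subr_ge0.
move=> zbv; move: (zb u) t1 tN; rewrite -(ltr_nat R) -(ler_nat R) natrM.
move: (extremal_value _ _ _) ltq qE qX qv zbv => q ltq qE qX qv zbv zbu t1 tN.
have leX : 0 <= (z v - (q - (2 * t%:R - 1)) * X) by lra.
(* This is the inequality at [v] with the quadratic for [q] substituted. By [leX] the left side is
   nonnegative, so both sides are 0. *)
have le2 : (q - (#|T|%:R - 1)) * (z v - (q - (2 * t%:R - 1)) * X)
    <= - \sum_(w | w != v) (X - z w).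
  rewrite SX mulrBr mulrA [_ * (q - (2 * _ - 1))]mulrC qE; lra.
have S00 : \sum_(w | w != v) (X - z w) = 0.
  by apply/eqP; rewrite eq_le S0 andbT; nra.
have zvE : z v = (q - (2 * t%:R - 1)) * X.
  by apply/eqP; rewrite -subr_eq0 eq_le leX andbT; rewrite S00 oppr0 pmulr_rle0 // in le2; lra.
have zuE w : w != v -> z w = X.
  move=> wv; have /psumr_eq0P E := S00; apply/eqP; rewrite eq_sym -subr_eq0.
  by apply/eqP/E => // w' /zX; rewrite subr_ge0.
have X1 : 0 < X by rewrite lt0r X0 andbT; apply: contraTneq Xv => XE; rewrite zvE XE; lra.
have := sum_neighbours_le e u zX; rewrite sym dom //= mul1r => le_s.
(* With all entries outside [v] equal to [X], the inequality at [u] bounds its degree from below. *)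
have : (2 * t%:R - 1) * X <= (2 * (deg e u)%:R - 1) * X.
  by move: zbu le_s; rewrite zuE // zvE; move: (\sum_(w | _) _) => s; clear; nra.
rewrite ler_pM2r // => le_d; apply/eqP; rewrite eqn_leq dt //= -(ler_nat R); lra.
Qed.

(** * Eigenvalues of real symmetric matrices and of the signless Laplacian *)

Lemma eigenvalue_signless_laplacianP (R : realType) (n : nat) (a : rel 'I_n) (b : R) :
  symmetric a ->
  eigenvalue (signless_laplacian R (SGraph a)) b <->
  exists z : 'I_n -> R, (exists v, z v != 0) /\
    forall v, (deg a v)%:R * z v + \sum_(u | a v u) z u = b * z v.
Proof.
move=> sym.
have E (z : 'rV[R]_n) v : (z *m signless_laplacian R (SGraph a)) 0 v =
    (deg a v)%:R * z 0 v + \sum_(u | a v u) z 0 u.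
  rewrite mxE; under eq_bigr do rewrite mxE mulrDr.
  rewrite big_split /=; congr (_ + _).
    rewrite (bigD1 v) //= eqxx mul1r big1 ?addr0 => [|i iv]; first exact: mulrC.
    by rewrite (negPf iv) mul0r mulr0.
  rewrite [RHS]big_mkcond; apply: eq_bigr => i _; rewrite sym.
  by case: (a v i); rewrite ?mulr1 ?mulr0.
split=> [/eigenvalueP[z zE z0]|[z [[v zv] zE]]].
  exists (z 0); split=> [|v]; first exact/rV0Pn.
  by rewrite -E zE mxE.
apply/eigenvalueP; exists (\row_i z i).
  apply/rowP=> w; rewrite E !mxE -zE; congr (_ + _).
  by apply: eq_bigr => u _; rewrite mxE.
by apply/rV0Pn; exists v; rewrite mxE.
Qed.

(** The characteristic polynomial has a complex root [l]. For an eigenvector [v], the product of [l]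
    with the positive real [c], the sum of the [|v_i|^2], is a Hermitian form and so self-conjugate;
    hence [l] is real. *)
Lemma symmetric_eigenvalue (R : rcfType) (n : nat) (A : 'M[R]_n) :
  (0 < n)%N -> A^T = A -> exists b, eigenvalue A b.
Proof.
move=> n0 symA; pose toC := real_complex R; pose B := map_mx toC A.
have /closed_rootP[l rl] : size (char_poly B) != 1%N.
  by rewrite size_char_poly eqSS -lt0n.
have /eigenvalueP[v vE v0] : eigenvalue B l by rewrite eigenvalue_root_char.
suff /complex_realP[b lE] : l \is Num.real.
  exists b; rewrite eigenvalue_root_char -(fmorph_root toC) map_char_poly.
  by rewrite /= -lE.
pose c := \sum_i `|v 0 i| ^+ 2.
have cE : l * c = \sum_i \sum_j v 0 j * B j i * (v 0 i)^*.
  rewrite mulr_sumr; apply: eq_bigr => i _.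
  have /rowP/(_ i) := vE; rewrite !mxE => /(congr1 ( *%R^~ (v 0 i)^*)).
  by rewrite -mulr_suml normCK mulrA => <-; rewrite mulr_suml.
have c0 : 0 < c.
  rewrite lt0r sumr_ge0 ?andbT => [|i _]; last by rewrite exprn_ge0.
  rewrite psumr_neq0 => [|i _]; last by rewrite exprn_ge0.
  have /rV0Pn[i vi] := v0; apply/hasP; exists i; first by rewrite mem_index_enum.
  by rewrite exprn_gt0 // normr_gt0.
have Breal i j : (B i j)^* = B j i.
  by rewrite !mxE -[in LHS]symA mxE; apply/CrealP/complex_realP; exists (A j i).
have cR : c^* = c by apply/CrealP/gtr0_real.
apply/CrealP/(mulIf (lt0r_neq0 c0)); rewrite -{1}cR -rmorphM cE [RHS]exchange_big.
rewrite rmorph_sum; apply: eq_bigr => i _; rewrite rmorph_sum; apply: eq_bigr => j _.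
by rewrite !rmorphM /= conjCK Breal; ring.
Qed.

(** The eigenvalues are the finitely many real roots of the characteristic polynomial; starting the
    maximum at the eigenvalue [b] keeps it among them. *)
Lemma largest_eigenvalue_exists (R : realType) (n : nat) (A : 'M[R]_n) :
  (0 < n)%N -> A^T = A -> exists q, largest_eigenvalue A q.
Proof.
move=> n0 symA; have [b bA] := symmetric_eigenvalue n0 symA.
have p0 : char_poly A != 0 by rewrite monic_neq0 ?char_poly_monic.
have rE c : eigenvalue A c = (c \in rootsR (char_poly A)).
  by rewrite eigenvalue_root_char -roots_on_rootsR // inE.
have bs : b \in rootsR (char_poly A) by rewrite -rE.
exists (\big[Num.max/b]_(c <- rootsR (char_poly A)) c); split=> [|c].
  rewrite rE big_seq; elim/big_ind: _ => // x y xs ys.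
  by rewrite /Num.max; case: ifP.
by rewrite rE => cs; apply: le_bigmax_seq cs _.
Qed.

(** * The case distinction on the largest degree *)

Lemma subeigen_extremal (R : rcfType) (T : finType) (e : rel T) (t : nat)
    (z : T -> R) (b : R) :
  symmetric e -> irreflexive e -> (4 <= t)%N -> (t ^ 2 + 4 * t + 1 <= #|T|)%N ->
  (forall x y, x != y -> #|[set w | e x w && e y w]| < t)%N ->
  (forall u, 0 <= z u) -> (exists u, z u != 0) ->
  (forall u, b * z u <= (deg e u)%:R * z u + \sum_(w | e u w) z w) ->
  b <= extremal_value R #|T| t /\
  (b = extremal_value R #|T| t ->
   exists v, (forall u, u != v -> e v u) /\ (forall u, u != v -> deg e u = t)).
Proof.
move=> sym irr t4 leT codeg z0 zn0 zb.
have [t1 tT] : (1 < t)%N /\ (2 * t <= #|T|)%N by move: t4 leT; clear; lia.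
have [ltq _] := extremal_valueP R t1 tT.
have small : b <= #|T|%:R -> b <= extremal_value R #|T| t /\
    (b = extremal_value R #|T| t ->
     exists v, (forall u, u != v -> e v u) /\ (forall u, u != v -> deg e u = t)).
  move=> leb; have ltb := le_lt_trans leb ltq; split=> [|E]; first exact: ltW.
  by rewrite E ltxx in ltb.
have [/existsP[v dv]|] := boolP [exists v, #|T| <= deg e v + t]%N; last first.
  rewrite negb_exists => /forallP lt_d; apply: small.
  apply: subeigen_le_deg z0 zn0 zb _ => v.
  by apply: (sum_deg_neighbours_le sym irr codeg leT); rewrite ltnNge lt_d.
have dT := deg_lt v irr.
(* [k] counts the vertices other than [v] that are not adjacent to [v]. *)
have [k dk] : {k | (deg e v + k.+1 = #|T|)%N}.
  by exists (#|T| - (deg e v).+1)%N; move: dT; clear; lia.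
have du u : u != v -> (deg e u + 2 * ~~ e v u <= t + k)%N.
  exact: deg_le_codeg sym irr codeg dk.
have T1 : (1 < #|T|)%N by move: t1 tT; clear; lia.
have [X [X0 zX Xv bX bv]] := subeigen_two_values sym irr T1 z0 zn0 zb dk du.
case: k => [|k] in dk du bX bv *.
  rewrite addn0 subr0 in bX bv.
  split=> [|bE]; first exact: subeigen_le_extremal bX bv.
  have dom u : u != v -> e v u.
    move=> uv; have : u \in [set~ v] by rewrite !inE.
    have /eqP <- : [set y | e v y] == [set~ v].
      rewrite eqEcard cardsC1 -dk addn1 leqnn andbT.
      by apply/subsetP=> y; rewrite !inE; apply: contraTneq => ->; rewrite irr.
    by rewrite inE.
  exists v; split=> // u uv; rewrite bE in zb.
  apply: (subeigen_extremal_deg sym irr t1 tT z0 zn0 zb dom) => // w wv.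
  by have := du w wv; rewrite addn0; apply: leq_trans; apply: leq_addr.
apply: small; apply: (subeigen_le_order t4 leT _ X0 (z0 v) Xv bX bv).
by move: dv dk; clear; lia.
Qed.

(** * The extremal value as an eigenvalue of [Fst 2 t n] *)

Lemma card_block (n t c : nat) : (1 + c.+1 * t <= n)%N -> (0 < t)%N ->
  #|[set y : 'I_n | (0 < y)%N && ((y - 1) %/ t == c)%N]| = t.
Proof.
move=> le_n t0.
have ltg (j : 'I_t) : (1 + (c * t + j) < n)%N.
  by have := ltn_ord j; move: le_n; rewrite mulSn; move: (c * t)%N (val j); clear; lia.
pose g j := Ordinal (ltg j).
have injg : injective g.
  by move=> i j /(congr1 val) /= /eqP; rewrite !eqn_add2l => /eqP/val_inj.
rewrite -[RHS]card_ord -cardsT -(card_imset _ injg); apply: eq_card => y; rewrite inE.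
apply/andP/imsetP => [[y0 /eqP yc]|[j _ ->]]; last first.
  by rewrite /= addKn divnMDl // divn_small ?addn0 // ltn_ord.
(* The position of [y] in its block is the remainder of [y - 1]. The condition [0 < y] keeps out
   vertex 0, which truncated subtraction would put in block 0. *)
exists (Ordinal (ltn_pmod (y - 1) t0)) => //; apply: val_inj => /=.
by rewrite -{1}yc -divn_eq subnKC.
Qed.

(** Since [n] is 1 modulo [t], every block is full: [x] is adjacent to vertex 0 and to the [t - 1]
    other vertices of its block. *)
Lemma Fst_neighbours (t n : nat) (x : 'I_n) : (0 < t)%N -> (n %% t = 1)%N -> (0 < x)%N ->
  #|[set y | adjg (Fst 2 t n) x y]| = t.
Proof.
move=> t0 nt x0; set S := [set y | _].
pose c := ((x - 1) %/ t)%N.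
have le_n : (1 + c.+1 * t <= n)%N.
  rewrite (divn_eq n t) nt addnC leq_add2r leq_mul2r; apply/orP; right.
  rewrite ltn_divLR // -(ltn_add2r 1) subnK //.
  by rewrite -[X in (_ < _ * _ + X)%N]nt -divn_eq.
have n0 : (0 < n)%N by apply: leq_ltn_trans (ltn_ord x).
pose o := Ordinal n0.
have := card_block le_n t0; set B := [set y | _] => cB.
have -> : S = o |: (B :\ x).
  apply/setP=> y; rewrite !inE /= -!val_eqE /= !ltnS !leqn0 [val x == 0]eqn0Ngt x0.
  rewrite lt0n [val x == val y]eq_sym [((x - 1) %/ t == _)%N]eq_sym.
  by case: (val y =P 0) => // ->; rewrite eq_sym -lt0n x0.
have := cardsD1 x B; rewrite cB inE x0 eqxx => E.
by rewrite cardsU1 !inE andbF [RHS]E.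
Qed.

Lemma Fst_eigenvalue (R : realType) (t n : nat) (a : rel 'I_n) :
  symmetric a -> (1 < t)%N -> (2 * t <= n)%N -> (n %% t = 1)%N ->
  isomorphic (SGraph a) (Fst 2 t n) ->
  eigenvalue (signless_laplacian R (SGraph a)) (extremal_value R n t).
Proof.
move=> sym t1 tn nt iso; apply/eigenvalue_signless_laplacianP => //.
pose F : rel 'I_n := adjg (Fst 2 t n).
have [f [bf fa]] : exists f : 'I_n -> 'I_n,
    bijective f /\ forall x y, a x y = F (f x) (f y).
  by have [f [bf fa]] := iso; exists f; split.
have degE (x : 'I_n) : deg a x = deg F (f x).
  have [g fK gK] := bf; rewrite /deg -(card_imset [set y | a x y] (bij_inj bf)).
  apply: eq_card => w; rewrite inE; apply/imsetP/idP => [[y]|Fw].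
    by rewrite inE fa => ? ->.
  by exists (g w); rewrite ?gK // inE fa gK.
have sumE (y : 'I_n -> R) (x : 'I_n) : \sum_(u | a x u) y (f u) = \sum_(w | F (f x) w) y w.
  by rewrite [RHS](reindex f) /=; [apply: eq_bigl => u; rewrite fa|exact: onW_bij].
have [ltq qE] := extremal_valueP R t1 tn.
have n0 : (0 < n)%N by move: t1 tn; clear; lia.
have t0 : (0 < t)%N by move: t1; clear; lia.
pose o := Ordinal n0; set q := extremal_value R n t in ltq qE *.
(* With entries 1 outside the centre, the equation [y o + (2 t - 1) = q] at such a vertex forces the
   central entry; the equation at the centre is then the quadratic for [q]. *)
pose y (w : 'I_n) := if w == o then q - (2 * t%:R - 1) else 1.
have main x : (deg F x)%:R * y x + \sum_(w | F x w) y w = q * y x.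
  have sum1 (P : pred 'I_n) : ~~ P o -> \sum_(w | P w) y w = #|[set w | P w]|%:R.
    move=> Po; rewrite -sum1_card natr_sum; apply: eq_big => [w|w Pw]; first by rewrite inE.
    by rewrite /y; case: eqP => // wo; rewrite -wo Pw in Po.
  have [->|xo] := eqVneq x o.
    have E : deg F o = (n - 1)%N.
      have <- : #|[set~ o]| = (n - 1)%N by rewrite cardsC1 card_ord subn1.
      by apply: eq_card => w; rewrite !inE /F /= [w == o]eq_sym andbT.
    rewrite sum1; last by rewrite /F /= ?eqxx.
    by rewrite -/(deg F o) E natrB // /y eqxx; lra.
  have x0 : (0 < x)%N by rewrite lt0n.
  have Fxo : F x o by rewrite /F /= xo orbT.
  have E : deg F x = t by apply: Fst_neighbours.
  rewrite (bigD1 o) //= sum1; last by rewrite eqxx andbF.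
  have -> : #|[set w | F x w & w != o]|%:R = t%:R - 1 :> R.
    rewrite -[in RHS]E /deg (cardsD1 o [set w | F x w]) inE Fxo [(_ + _)%:R]natrD addrAC subrr add0r.
    by congr _%:R; apply: eq_card => w; rewrite !inE andbC.
  by rewrite E /y eqxx (negPf xo); lra.
exists (y \o f); split=> [|v /=]; last by rewrite degE sumE main.
have [g fK gK] := bf.
have [w wo] : exists w : 'I_n, w != o.
  have n1 : (1 < n)%N by move: t1 tn; clear; lia.
  by exists (Ordinal n1).
by exists (g w); rewrite /= gK /y (negPf wo) oner_eq0.
Qed.

(** * The bound for all eigenvalues and the characterisation of equality *)

Unset Implicit Arguments.

Theorem theorem1p3 (R : realType) (t n : nat) (adj : rel 'I_n)
  (Hsym : symmetric adj) (Hirr : irreflexive adj)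
  (Ht : (4 <= t)%N) (Hn : (t ^ 2 + 4 * t + 1 <= n)%N)
  (Hfree : minor_free (Kst 2 t) (SGraph adj)) :
  exists q : R,
    largest_eigenvalue (signless_laplacian R (SGraph adj)) q /\
    q <= (n%:R + 2 * t%:R - 2
          + Num.sqrt ((n%:R - 2 * t%:R + 2) ^+ 2 + 8 * t%:R - 8)) / 2 /\
    (q = (n%:R + 2 * t%:R - 2
          + Num.sqrt ((n%:R - 2 * t%:R + 2) ^+ 2 + 8 * t%:R - 8)) / 2
     <-> (n %% t = 1)%N /\ isomorphic (SGraph adj) (Fst 2 t n)).
Proof.
have [t1 tn n0] : [/\ 1 < t, 2 * t <= n & 0 < n]%N by move: Ht Hn; clear; split; lia.
rewrite -/(extremal_value R n t).
have symQ : (signless_laplacian R (SGraph adj))^T = signless_laplacian R (SGraph adj).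
  apply/matrixP=> i j; rewrite !mxE /= Hsym eq_sym; congr (_ + _).
  by have [->|] := eqVneq j i => //; rewrite !mul0r.
have codeg x y : x != y -> (#|[set w | adj x w && adj y w]| < t)%N.
  exact: minor_free_common_neighbours.
have bound b : eigenvalue (signless_laplacian R (SGraph adj)) b ->
    b <= extremal_value R n t /\
    (b = extremal_value R n t -> exists v,
       (forall u, u != v -> adj v u) /\ (forall u, u != v -> deg adj u = t)).
  case/eigenvalue_signless_laplacianP => // z [[v zv] zE].
  have := @subeigen_extremal R _ adj t (fun u => `|z u|) b Hsym Hirr Ht.
  rewrite card_ord; apply=> // [|u].
    by exists v; rewrite normr_eq0.
  (* Replacing [b] by its absolute value covers negative eigenvalues; the rest is the triangle
     inequality. *)
  apply: le_trans (ler_wpM2r (normr_ge0 _) (ler_norm b)) _.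
  rewrite -normrM -zE; apply: le_trans (ler_normD _ _) _.
  by rewrite normrM normr_nat lerD2l ler_norm_sum.
have [q qmax] := largest_eigenvalue_exists n0 symQ.
exists q; split=> //; have [leq qeq] := bound q qmax.1; split=> //; split.
  move=> /qeq[v [dom degt]].
  have cardB x : x != v -> #|clnbhd adj v x| = t.
    by move=> xv; rewrite card_clnbhd 1?[adj x v]Hsym ?dom //; apply: degt.
  apply: (clnbhd_eq_isomorphic_Fst Hsym Hirr t1 dom cardB) => x y axy xv yv.
  apply: (clnbhd_adjacent Hsym Hirr Ht dom degt codeg _ axy xv yv) => u w auw uv wv.
  exact: minor_free_edge_neighbours Hsym Hirr Hfree dom auw uv wv.
(* The extremal value is an eigenvalue here, hence at most [q]. *)
case=> nt iso; apply/le_anti; rewrite leq /=.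
by apply: qmax.2; apply: Fst_eigenvalue.
Qed.
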